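(* Let $G$ be a finite digraph and $a=\{a_p\}_{p=0}^\infty$ a sequence of positive numbers, with $a_{-1}:=1$. Then for all $p\ge0$ $$\operatorname{spec}_+\Delta_p^{(a)}=\frac{a_{p+1}}{a_p}\operatorname{spec}_+\mathcal K_p\ \sqcup\ \frac{a_p}{a_{p-1}}\operatorname{spec}_+\mathcal L_p$$ and $$\operatorname{spec}_+\Delta_p^{(a)}=\frac{a_p}{a_{p-1}}\operatorname{spec}_+\mathcal L_p\ \sqcup\ \frac{a_{p+1}}{a_p}\operatorname{spec}_+\mathcal L_{p+1}.$$
   Context: A digraph $G=(V,E)$ consists of a finite vertex set $V$ and a set $E$ of ordered pairs of distinct vertices (arrows), written $i\to j$. An elementary $p$-path ($p\ge 0$) is a sequence $i_0\dots i_p$ of vertices, with associated basis symbol $e_{i_0\dots i_p}$; it is regular if $i_{k-1}\ne i_k$ for all $k$, and allowed if $i_{k-1}\to i_k$ for all $k$. $\mathcal R_p$ is the real vector space with basis the regular elementary $p$-paths. The boundary operator $\partial:\mathcal R_p\to\mathcal R_{p-1}$ is $\partial e_{i_0\dots i_p}=\sum_{k=0}^p(-1)^k e_{i_0\dots\widehat{i_k}\dots i_p}$, where every non-regular term on the right is replaced by $0$; and $\mathcal R_{-1}=\{0\}$, $\partial e_i=0$. $\mathcal A_p\subset\mathcal R_p$ is the span of the allowed elementary $p$-paths ($\mathcal A_{-1}=\{0\}$), and $\Omega_p=\Omega_p(G)=\{u\in\mathcal A_p:\partial u\in\mathcal A_{p-1}\}$. Then $\partial\Omega_p\subset\Omega_{p-1}$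 and $\partial^2=0$. The canonical inner product $\langle\cdot,\cdot\rangle$ on $\mathcal R_p$ makes the regular elementary paths orthonormal; it is restricted to $\Omega_p$. $\partial^*:\Omega_{p-1}\to\Omega_p$ is the adjoint of $\partial:\Omega_p\to\Omega_{p-1}$ for the canonical inner products, and $\mathcal K_p=\partial\partial^*|_{\Omega_p}$, $\mathcal L_p=\partial^*\partial|_{\Omega_p}$ (so $\mathcal L_0=0$). The weighted inner product on $\mathcal R_p$ is $\langle\cdot,\cdot\rangle_a=\frac1{a_p}\langle\cdot,\cdot\rangle$; $\partial_a^*:\Omega_{p-1}\to\Omega_p$ is the adjoint of $\partial$ for the weighted inner products, and the weighted Hodge Laplacian is $\Delta_p^{(a)}=\partial\partial_a^*+\partial_a^*\partial$ on $\Omega_p$. $\operatorname{spec}A$ is the multiset of eigenvalues of a self-adjoint operator $A$, counted with multiplicity, and $\operatorname{spec}_+A$ is obtained by removing all zero eigenvalues. $\sqcup$ is disjoint union of multisets (multiplicities add), and $c\{\lambda_i\}=\{c\lambda_i\}$. *)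

(* Defs.v *)
From HB Require Import structures.
From mathcomp Require Import all_boot all_order all_algebra.
From mathcomp Require Import finmap multiset.
From mathcomp Require Import boolp classical_sets functions cardinality reals.
From mathcomp Require Import polyrcf.

Set Implicit Arguments.
Unset Strict Implicit.
Unset Printing Implicit Defensive.

Import Order.TTheory GRing.Theory Num.Theory.
Import passmx.
Local Open Scope ring_scope.

Record digraph := Digraph {
  vertex :> finType;
  arrow : rel vertex;
  arrow_irr : irreflexive arrow }.

(** A path is the tuple of its vertices, and chains are indexed by the number [n]
of vertices: degree [p] is [n = p.+1], and [n = 0] is degree -1.  The empty
tuple is not a path, so that the chain space of degree -1 is zero. *)

Section Chains.
Variables (R : realType) (G : digraph).

Definition regular n (t : n.-tuple G) : bool :=
  (0 < n)%N && sorted [rel i j | i != j] t.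

Definition allowed n (t : n.-tuple G) : bool :=
  (0 < n)%N && sorted (@arrow G) t.

Definition chain n := {ffun {t : n.-tuple G | regular t} -> R^o}.

(** The basis symbol of [t]; it is [0] when [t] is not regular. *)
Definition elem n (t : n.-tuple G) : chain n := [ffun x => (val x == t)%:R].

Definition face n (t : n.+1.-tuple G) (k : 'I_n.+1) : n.-tuple G :=
  [tuple tnth t (lift k j) | j < n].

Definition boundary_fun n (u : chain n.+1) : chain n :=
  \sum_x u x *: \sum_(k < n.+1) (-1) ^+ k *: elem (face (val x) k).

Fact boundary_fun_is_linear n : linear (@boundary_fun n).
Proof.
move=> a u v; rewrite /boundary_fun scaler_sumr -big_split /=.
by apply: eq_bigr => x _; rewrite !ffunE scalerDl scalerA.
Qed.
HB.instance Definition _ n := GRing.isLinear.Build R (chain n.+1) (chain n) _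
  (@boundary_fun n) (@boundary_fun_is_linear n).

Definition boundary n : 'Hom(chain n.+1, chain n) := linfun (@boundary_fun n).

Definition allowed_chains n : {vspace chain n} :=
  <<[seq elem t | t : n.-tuple G in @allowed n]>>%VS.

Definition Omega n : {vspace chain n} :=
  match n with
  | 0 => allowed_chains 0
  | m.+1 => (allowed_chains m.+1 :&: boundary m @^-1: allowed_chains m)%VS
  end.

Definition OmegaT n : vectType R := subvs_of (Omega n).

(** [vsproj] only serves to land in the subtype: [boundary n] maps
[Omega n.+1] into [Omega n], where [vsproj] is the identity. *)
Definition dOmega n : 'Hom(OmegaT n.+1, OmegaT n) :=
  (linfun (vsproj (Omega n)) \o boundary n \o linfun vsval)%VF.

Definition dot n (u v : chain n) : R := \sum_x u x * v x.

(** [weight a n] is the weight in degree [n - 1], with the convention that it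
is [1] in degree -1. *)
Definition weight (a : nat -> R) n : R := if n is p.+1 then a p else 1.

Definition wdot a n (u v : chain n) : R := (weight a n)^-1 * dot u v.

Definition dotOmega n (u v : OmegaT n) : R := dot (vsval u) (vsval v).

Definition wdotOmega a n (u v : OmegaT n) : R := wdot a (vsval u) (vsval v).

End Chains.

Definition is_adjoint (R : realType) (U W : vectType R)
    (dotU : U -> U -> R) (dotW : W -> W -> R)
    (f : 'Hom(U, W)) (g : 'Hom(W, U)) : Prop :=
  forall u w, dotW (f u) w = dotU u (g w).

(** On inner products the default value [0] is not used: see [adjointP]. *)
Definition adjoint (R : realType) (U W : vectType R)
    (dotU : U -> U -> R) (dotW : W -> W -> R) (f : 'Hom(U, W)) : 'Hom(W, U) :=
  xget 0 [set g | is_adjoint dotU dotW f g]%classic.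

Lemma adjointP (R : realType) (U W : vectType R)
    (dotU : U -> U -> R) (dotW : W -> W -> R) (f : 'Hom(U, W)) :
    (forall u, scalar (dotU u)) -> (forall u, scalar (dotU^~ u)) ->
    (forall w, scalar (dotW w)) -> (forall w, scalar (dotW^~ w)) ->
    (forall u, dotU u u = 0 -> u = 0) ->
  is_adjoint dotU dotW f (adjoint dotU dotW f).
Proof.
move=> linUr linUl linWr linWl anisoU.
rewrite /adjoint; case: xgetP => [g _ //|noadj]; exfalso.
pose d := \dim {:U}; pose e := vbasis {:U}.
pose phi u : 'rV[R]_d := \row_i dotU e`_i u.
pose psi w : 'rV[R]_d := \row_i dotW (f e`_i) w.
have phi_lin : linear phi.
  by move=> c u v; apply/rowP => i; rewrite !mxE linUr.
have psi_lin : linear psi.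
  by move=> c u v; apply/rowP => i; rewrite !mxE linWr.
pose phiL : {linear U -> 'rV[R]_d} :=
  HB.pack phi (GRing.isLinear.Build _ _ _ _ phi phi_lin).
pose psiL : {linear W -> 'rV[R]_d} :=
  HB.pack psi (GRing.isLinear.Build _ _ _ _ psi psi_lin).
have ext (h1 h2 : U -> R) : scalar h1 -> scalar h2 ->
    (forall i : 'I_d, h1 e`_i = h2 e`_i) -> h1 =1 h2.
  move=> l1 l2 h12 u.
  pose H1 : {scalar U} := HB.pack h1 (GRing.isLinear.Build _ _ _ _ h1 l1).
  pose H2 : {scalar U} := HB.pack h2 (GRing.isLinear.Build _ _ _ _ h2 l2).
  rewrite -[h1 u]/(H1 u) -[h2 u]/(H2 u).
  rewrite (coord_vbasis (memvf u)) !linear_sum; apply: eq_bigr => i _.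
  by rewrite !linearZ; congr (_ * _); apply: h12.
have ker0 : lker (linfun phiL) = 0%VS.
  apply/eqP; rewrite -subv0; apply/subvP => u; rewrite memv_ker lfunE memv0.
  move=> /eqP phiu0; apply/eqP/anisoU.
  apply: (ext (dotU^~ u) (fun=> 0)) => //.
    by move=> c x y; rewrite mulr0 addr0.
  by move=> i; move/rowP/(_ i): phiu0; rewrite !mxE.
have imT : limg (linfun phiL) = fullv.
  apply/eqP; rewrite eqEdim subvf /=.
  have := limg_ker_dim (linfun phiL) {:U}.
  by rewrite ker0 capv0 dimv0 add0n => ->; rewrite dimvf /dim /= mul1n.
pose g := ((linfun phiL)^-1 \o linfun psiL)%VF.
apply: (noadj g) => u w.
apply: (ext (fun u => dotW (f u) w) (dotU^~ (g w))) => //.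
  by move=> c x y; rewrite linearP linWl.
move=> i; have : linfun phiL (g w) = psi w.
  by rewrite /g comp_lfunE limg_lfunVK ?imT ?memvf// lfunE.
by rewrite lfunE => /rowP/(_ i); rewrite !mxE.
Qed.

(** The degree of [opK p], [opL p] and [hodge a p] is [p], hence [p.+1] below;
[dstar n] and [wdstar n] are still indexed by the number of vertices. *)

Section Hodge.
Variables (R : realType) (G : digraph).

Definition dstar n : 'Hom(OmegaT R G n, OmegaT R G n.+1) :=
  adjoint (@dotOmega R G n.+1) (@dotOmega R G n) (dOmega R G n).

Definition wdstar a n : 'Hom(OmegaT R G n, OmegaT R G n.+1) :=
  adjoint (wdotOmega a (n := n.+1)) (wdotOmega a (n := n)) (dOmega R G n).

Definition opK p : 'End(OmegaT R G p.+1) := (dOmega R G p.+1 \o dstar p.+1)%VF.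

Definition opL p : 'End(OmegaT R G p.+1) := (dstar p \o dOmega R G p)%VF.

Definition hodge a p : 'End(OmegaT R G p.+1) :=
  ((dOmega R G p.+1 \o wdstar a p.+1) + (wdstar a p \o dOmega R G p))%VF.

End Hodge.

Section Spectrum.
Variables (R : realType) (U : vectType R).

(** For a self-adjoint operator the multiplicity of an eigenvalue is the
dimension of its eigenspace. *)
Definition spec (f : 'End(U)) : {mset R}%mset :=
  [fsfun x in fset_set [set x | leigenvalue f x]%classic =>
    \dim (leigenspace f x)].

Lemma specE (f : 'End(U)) x : spec f x = \dim (leigenspace f x).
Proof.
rewrite /spec fsfunE in_fset_set; last first.
  pose A := mxof (vbasis {:U}) (vbasis {:U}) f.
  apply: (sub_finite_set (B := [set` rootsR (char_poly A)])%classic).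
    move=> y /= evy.
    have := roots_on_rootsR (monic_neq0 (char_poly_monic A)) y.
    rewrite in_itv /= => <-; rewrite -eigenvalue_root_char.
    have eb := vbasisP {:U}.
    apply: contra_neqT evy; rewrite /eigenvalue negbK => /eqP e0.
    by rewrite (leigenspaceE eb) e0 vsof0.
  exact: finite_seq.
case: (boolP (leigenvalue f x)) => ev; first by rewrite mem_set.
rewrite memNset /=; last exact/negP.
by move: ev; rewrite negbK => /eqP->; rewrite dimv0.
Qed.

End Spectrum.

Definition spec_pos (R : realType) (U : vectType R) (f : 'End(U)) : {mset R}%mset :=
  seq_mset [seq x <- spec f | x != 0].

Definition mset_scale (R : realType) (c : R) (A : {mset R}%mset) : {mset R}%mset :=
  seq_mset [seq c * x | x <- A].

(* Main.v *)
Require Import Defs.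
From mathcomp Require Import all_boot all_order all_algebra.
From mathcomp Require Import finmap multiset.
From mathcomp Require Import reals.
From mathcomp Require Import zify.

Import Order.TTheory GRing.Theory Num.Theory passmx.
Local Open Scope ring_scope.
Local Open Scope mset_scope.

Set Implicit Arguments.
Unset Strict Implicit.
Unset Printing Implicit Defensive.

(** Rescaling the inner product in every degree [p] by [1 / a_p] multiplies the
adjoint of the boundary from degree [p+1] to degree [p] by [a_(p+1) / a_p]
([wdstarE]).  Hence the weighted Laplacian is the combination
[(a_(p+1) / a_p) K_p + (a_p / a_(p-1)) L_p] of the two unweighted operators
([hodgeE]).

Since the boundary squares to zero on invariant chains, so does its adjoint, and
therefore [K_p L_p = L_p K_p = 0] ([opK_opL], [opL_opK]).  When two operators
annihilate each other, the eigenspace of their sum for [x != 0] is the direct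
sum of their eigenspaces for the same [x]; so nonzero spectra add up
([spec_posD]), and they scale with the operator ([spec_posZ]).  This is the
first identity.  The second follows from [K_p = d d*] and [L_(p+1) = d* d],
because [f g] and [g f] have the same nonzero spectrum ([spec_pos_compC]).

The only combinatorial input is [boundary_boundary]: non-regular terms are
discarded from the boundary, and this is consistent with the usual
simplicial cancellation because the alternating sum of the faces of a
non-regular path already vanishes ([alt_faces_nonregular]).

The inner products enter only through the adjoints: the statements on
eigenspaces are purely linear. *)

(** * Nonzero spectra of operators *)

Section NonzeroSpectrum.
Variable R : realType.
Implicit Types U W : vectType R.

Lemma mset_scaleE (c : R) (A : {mset R}) x :
  c != 0 -> mset_scale c A x = A (x / c).
Proof.
move=> c0; rewrite /mset_scale mset_seqE count_map -count_mem_mset.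
apply: eq_count => y /=; rewrite mulrC.
by apply/eqP/eqP => [<-|->]; rewrite ?mulfK ?mulfVK.
Qed.

Lemma spec_posE U (f : 'End(U)) x :
  spec_pos f x = if x == 0 then 0%N else \dim (leigenspace f x).
Proof.
rewrite /spec_pos mset_seqE count_filter -specE -count_mem_mset.
have [->|x0] := eqVneq x 0.
  by rewrite -[RHS](count_pred0 (spec f)); apply: eq_count => y /=; case: eqVneq.
by apply: eq_count => y /=; case: eqVneq => // ->; rewrite x0.
Qed.

Lemma memv_leigenspace U (f : 'End(U)) x v :
  (v \in leigenspace f x) = (f v == x *: v).
Proof.
by rewrite /leigenspace memv_ker add_lfunE opp_lfunE scale_lfunE id_lfunE subr_eq0.
Qed.

Lemma leigenspaceZ U (f : 'End(U)) c x :
  c != 0 -> leigenspace (c *: f) x = leigenspace f (x / c).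
Proof.
move=> c0; apply/vspaceP => v; rewrite !memv_leigenspace scale_lfunE.
by rewrite -(inj_eq (scalerI c0) (f v)) scalerA mulrC mulfVK.
Qed.

Lemma spec_posZ U (f : 'End(U)) c :
  c != 0 -> spec_pos (c *: f) = mset_scale c (spec_pos f).
Proof.
move=> c0; apply/msetP => x; rewrite (mset_scaleE _ _ c0).
rewrite [LHS]spec_posE [RHS]spec_posE (leigenspaceZ _ _ c0).
by rewrite mulf_eq0 invr_eq0 (negPf c0) orbF.
Qed.

(** If [(f + g) v = x v], applying [f] gives [f (f v) = x (f v)], and likewise
for [g]; so [v = x^-1 (f v) + x^-1 (g v)] splits [v] into eigenvectors.
Conversely [g] kills the eigenvectors of [f] for [x != 0], which are in the
image of [f]. *)
Lemma leigenspaceD U (f g : 'End(U)) (x : R) :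
    (f \o g = 0)%VF -> (g \o f = 0)%VF -> x != 0 ->
  leigenspace (f + g) x = (leigenspace f x + leigenspace g x)%VS.
Proof.
move=> fg0 gf0 x0.
have fg v : f (g v) = 0 by rewrite -comp_lfunE fg0 zero_lfunE.
have gf v : g (f v) = 0 by rewrite -comp_lfunE gf0 zero_lfunE.
have unscale (h : 'End(U)) w : h (x *: w) = 0 -> h w = 0.
  by rewrite linearZ /= => /eqP; rewrite scaler_eq0 (negPf x0) => /eqP.
apply/vspaceP => v; rewrite memv_leigenspace add_lfunE.
apply/eqP/memv_addP => [fgv|[u + [w + ->]]]; last first.
  rewrite !memv_leigenspace => /eqP fu /eqP gw.
  have gu : g u = 0 by apply: unscale; rewrite -fu gf.
  have fw : f w = 0 by apply: unscale; rewrite -gw fg.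
  by rewrite (linearD f) (linearD g) /= fu gw gu fw addr0 add0r scalerDr.
exists (x^-1 *: f v).
  rewrite memv_leigenspace scalerA divff// scale1r linearZ /=.
  have -> : f (f v) = x *: f v.
    by have := congr1 f fgv; rewrite linearD linearZ /= fg addr0.
  by rewrite scalerA mulVf// scale1r.
exists (x^-1 *: g v).
  rewrite memv_leigenspace scalerA divff// scale1r linearZ /=.
  have -> : g (g v) = x *: g v.
    by have := congr1 g fgv; rewrite linearD linearZ /= gf add0r.
  by rewrite scalerA mulVf// scale1r.
by rewrite -scalerDr fgv scalerA mulVf// scale1r.
Qed.

(** The sum of eigenspaces in [leigenspaceD] is direct: a common eigenvector
[v] satisfies [x^2 v = f (g v) = 0]. *)
Lemma spec_posD U (f g : 'End(U)) :
    (f \o g = 0)%VF -> (g \o f = 0)%VF ->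
  spec_pos (f + g) = spec_pos f `+` spec_pos g.
Proof.
move=> fg0 gf0; apply/msetP => x; rewrite msetE2 [LHS]spec_posE.
rewrite [X in (X + _)%N]spec_posE [X in (_ + X)%N]spec_posE.
have [//|x0] := eqVneq x 0.
rewrite leigenspaceD// dimv_disjoint_sum//.
apply/eqP; rewrite -subv0; apply/subvP => v; rewrite memv_cap !memv_leigenspace.
move=> /andP[/eqP fv /eqP gv]; rewrite memv0.
have : (f \o g)%VF v = 0 by rewrite fg0 zero_lfunE.
rewrite comp_lfunE gv linearZ /= fv => /eqP.
by rewrite !scaler_eq0 (negPf x0).
Qed.

(** The map [f] intertwines [g \o f] with [f \o g], and it is injective on the
eigenspace since [g (f v) = x v] with [x != 0]. *)
Lemma dim_leigenspace_comp U W (f : 'Hom(U, W)) (g : 'Hom(W, U)) x :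
    x != 0 ->
  (\dim (leigenspace (g \o f)%VF x) <= \dim (leigenspace (f \o g)%VF x))%N.
Proof.
move=> x0; rewrite -(limg_dim_eq (f := f)).
  apply/dimvS/subvP => _ /memv_imgP[u + ->]; rewrite !memv_leigenspace !comp_lfunE.
  by move=> /eqP ->; rewrite linearZ.
apply/eqP; rewrite -subv0; apply/subvP => v.
rewrite memv_cap memv_leigenspace memv_ker comp_lfunE memv0.
move=> /andP[+ /eqP fv0]; rewrite fv0 linear0 eq_sym scaler_eq0.
by rewrite (negPf x0).
Qed.

Lemma spec_pos_compC U W (f : 'Hom(U, W)) (g : 'Hom(W, U)) :
  spec_pos (f \o g)%VF = spec_pos (g \o f)%VF.
Proof.
apply/msetP => x; rewrite [LHS]spec_posE [RHS]spec_posE.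
have [//|x0] := eqVneq x 0.
by apply/eqP; rewrite eqn_leq !dim_leigenspace_comp.
Qed.

End NonzeroSpectrum.

(** * The boundary operator squares to zero *)

Section BoundarySquared.
Variables (R : realType) (G : digraph).

(** The boundary formula applied to an arbitrary, possibly non-regular, path:
the faces of a regular path need not be regular. *)
Definition alt_faces n (t : n.+1.-tuple G) : chain R G n :=
  \sum_(k < n.+1) (-1) ^+ k *: elem R (face t k).

Lemma nth_face x0 n (t : n.+1.-tuple G) (k : 'I_n.+1) j :
  (j < n)%N -> nth x0 (face t k) j = nth x0 t (bump k j).
Proof.
move=> jn; rewrite -[j]/(val (Ordinal jn)) -tnth_nth tnth_mktuple.
by rewrite (tnth_nth x0).
Qed.

Lemma elem_nonregular n (t : n.-tuple G) : ~~ regular t -> elem R t = 0.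
Proof.
move=> nt; apply/ffunP => x; rewrite !ffunE.
by case: eqP nt => // <-; rewrite (valP x).
Qed.

(** If the vertices [i] and [i+1] of [t] coincide, deleting either one gives the
same path, with opposite signs; deleting any other vertex leaves the
repetition in place. *)
Lemma alt_faces_nonregular n (t : n.+1.-tuple G) :
  ~~ regular t -> alt_faces t = 0.
Proof.
move=> nreg; pose x0 := thead t.
have [i ti] : exists i : 'I_n, nth x0 t i = nth x0 t i.+1.
  suff /existsP[i /eqP ti] : [exists i : 'I_n, nth x0 t i == nth x0 t i.+1].
    by exists i.
  apply: contraNT nreg => /existsPn h.
  rewrite /regular /=; apply/(sortedP x0) => i; rewrite size_tuple ltnS => lin.
  by have /= := h (Ordinal lin).
have lin := ltn_ord i.
pose i0 : 'I_n.+1 := inord i; pose i1 : 'I_n.+1 := inord i.+1.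
have i0E : i0 = i :> nat by rewrite inordK; lia.
have i1E : i1 = i.+1 :> nat by rewrite inordK; lia.
rewrite /alt_faces (bigD1 i0)// (bigD1 i1)/=; last first.
  by rewrite -val_eqE /= i0E i1E; lia.
rewrite big1 ?addr0.
  have -> : face t i0 = face t i1.
    apply: eq_from_tnth => j; rewrite !(tnth_nth x0) !nth_face// i0E i1E.
    have [->|ji] := eqVneq (j : nat) i; first by rewrite /bump leqnn ltnn.
    by congr nth; rewrite /bump; lia.
  by rewrite i0E i1E exprS mulN1r scaleNr subrr.
move=> k /andP[]; rewrite -!val_eqE /= i0E i1E => ki0 ki1.
rewrite elem_nonregular ?scaler0//; apply/negP => /andP[_].
move=> /(sortedP x0); rewrite size_tuple => h.
have ltk := ltn_ord k.
have [lki|lik] := ltnP k i.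
  have bump_pred : bump k i.-1 = i by rewrite /bump; lia.
  have bump_i : bump k i = i.+1 by rewrite /bump; lia.
  have := h i.-1; rewrite prednK; last lia.
  move=> /(_ lin) /=; rewrite !nth_face; try lia.
  by rewrite bump_pred bump_i ti eqxx.
have bump_i : bump k i = i by rewrite /bump; lia.
have bump_iS : bump k i.+1 = i.+1 by rewrite /bump; lia.
have ltin : (i.+1 < n)%N by lia.
have /= := h i ltin; rewrite !nth_face//.
by rewrite bump_i bump_iS ti eqxx.
Qed.

(** This also holds when [t] is not regular, both sides being zero, so the
boundary can be iterated without separating the regular faces from the
others. *)
Lemma boundary_elem n (t : n.+1.-tuple G) :
  boundary R G n (elem R t) = alt_faces t.
Proof.
rewrite lfunE /=; have [rt|nrt] := boolP (regular t); last first.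
  by rewrite elem_nonregular// linear0 alt_faces_nonregular.
rewrite /boundary_fun (bigD1 (Sub t rt))//= [X in _ + X]big1 ?addr0.
  by rewrite ffunE eqxx scale1r.
by move=> x; rewrite -val_eqE ffunE /= => /negPf ->; rewrite scale0r.
Qed.

(** Each pair of vertices of [t] can be deleted in two orders, with opposite
signs. *)
Lemma boundary_alt_faces n (t : n.+2.-tuple G) :
  boundary R G n (alt_faces t) = 0.
Proof.
rewrite linear_sum /=.
under eq_bigr => k _ do rewrite linearZ /= boundary_elem scaler_sumr.
rewrite pair_bigA /=; set S := \sum_p _.
(* Deleting [p.1] and then [p.2] removes from [t] the vertices [p.1] and
   [lift p.1 p.2]; [swap] deletes the same two vertices in the other order. *)
pose swap (p : 'I_n.+2 * 'I_n.+1) : 'I_n.+2 * 'I_n.+1 :=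
  (lift p.1 p.2, inord (unbump (lift p.1 p.2) p.1)).
have swapE p : (swap p).2 = unbump (bump p.1 p.2) p.1 :> nat.
  case: p => k l; have := ltn_ord k; have := ltn_ord l.
  by rewrite /= => ? ?; rewrite inordK// /unbump /bump; lia.
have swapK : involutive swap.
  move=> p; have E := swapE (swap p); have E1 := swapE p.
  rewrite [RHS]surjective_pairing [LHS]surjective_pairing.
  congr pair; apply/val_inj.
    by rewrite /= E1 /bump /unbump; lia.
  by apply: etrans E _; rewrite E1 /= /bump /unbump; lia.
suff SN : S = - S.
  have /eqP : 2%:R *: S = 0 by rewrite scaler_nat mulr2n {1}SN addNr.
  by rewrite scaler_eq0 pnatr_eq0 => /eqP.
rewrite [in RHS]/S (reindex_inj (inv_inj swapK)) /= -sumrN.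
apply: eq_bigr => p _; have /= swap2E := swapE p.
rewrite !scalerA -!exprD -scaleNr; congr (_ *: elem R _).
  rewrite -[RHS]mulN1r -exprS -[LHS]signr_odd -[RHS]signr_odd; congr (_ ^+ _).
  by rewrite swap2E /bump /unbump; lia.
apply: eq_from_tnth => j; rewrite !tnth_mktuple; congr tnth; apply/val_inj.
by rewrite /= swap2E /bump /unbump; lia.
Qed.

Lemma boundary_boundary n (u : chain R G n.+2) :
  boundary R G n (boundary R G n.+1 u) = 0.
Proof.
rewrite [boundary R G n.+1 u]lfunE /= linear_sum big1//= => x _.
by rewrite linearZ /= boundary_alt_faces scaler0.
Qed.

End BoundarySquared.

(** * Adjoints on the spaces of invariant chains *)

Section Adjoints.
Variables (R : realType) (G : digraph).

(** The projection in [dOmega] acts as the identity: for [u] invariant, the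
boundary of [u] is allowed, and invariant because its own boundary is zero. *)
Lemma val_dOmega n (u : OmegaT R G n.+1) :
  vsval (dOmega R G n u) = boundary R G n (vsval u).
Proof.
have du : boundary R G n (vsval u) \in Omega R G n.
  have : vsval u \in Omega R G n.+1 by apply: subvsP.
  rewrite [Omega R G n.+1]/= memv_cap -memv_preim => /andP[_].
  case: n u => [|n] u // du.
  by rewrite [Omega _ _ _]/= memv_cap du -memv_preim boundary_boundary mem0v.
have vsvalE v : linfun (vsval : OmegaT R G n.+1 -> _) v = vsval v by rewrite lfunE.
by rewrite /dOmega !comp_lfunE vsvalE lfunE /= vsprojK.
Qed.

Lemma dOmega_dOmega n (u : OmegaT R G n.+2) :
  dOmega R G n (dOmega R G n.+1 u) = 0.
Proof. by apply/val_inj; rewrite /= !val_dOmega boundary_boundary. Qed.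

Lemma dotC n (u v : chain R G n) : dot u v = dot v u.
Proof. by apply: eq_bigr => x _; rewrite mulrC. Qed.

Lemma dot_linear n (u : chain R G n) : scalar (dot u).
Proof.
move=> c v w; rewrite /dot mulr_sumr -big_split; apply: eq_bigr => x _ /=.
by rewrite !ffunE mulrDr mulrCA.
Qed.

Lemma dot_eq0 n (u : chain R G n) : dot u u = 0 -> u = 0.
Proof.
move=> /eqP; rewrite psumr_eq0 => [/allP h|x _]; last by rewrite -expr2 sqr_ge0.
apply/ffunP => x; rewrite ffunE.
by have := h x (mem_index_enum _); rewrite mulf_eq0 orbb => /eqP.
Qed.

Lemma dotOmegaC n (u v : OmegaT R G n) : dotOmega u v = dotOmega v u.
Proof. exact: dotC. Qed.

Lemma dotOmega_linear n (u : OmegaT R G n) : scalar (dotOmega u).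
Proof. by move=> c v w; rewrite /dotOmega linearP dot_linear. Qed.

Lemma dotOmega0 n (u : OmegaT R G n) : dotOmega u 0 = 0.
Proof. by rewrite /dotOmega /dot big1// => x _; rewrite !ffunE mulr0. Qed.

Lemma dotOmega_eq0 n (u : OmegaT R G n) : dotOmega u u = 0 -> u = 0.
Proof. by move=> /dot_eq0 u0; apply/val_inj. Qed.

(** Nondegeneracy: this is what makes adjoints unique. *)
Lemma dotOmegaI n (v w : OmegaT R G n) :
  (forall u, dotOmega u v = dotOmega u w) -> v = w.
Proof.
move=> h; apply/eqP; rewrite -subr_eq0; apply/eqP/dotOmega_eq0.
have /= := dotOmega_linear (v - w) (-1) w v.
by rewrite scaleN1r mulN1r h addNr addrC.
Qed.

Lemma dstarP n (u : OmegaT R G n.+1) w :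
  dotOmega (dOmega R G n u) w = dotOmega u (dstar R G n w).
Proof.
apply: adjointP => [v|v|v|v|]; try exact: dotOmega_linear; last exact: dotOmega_eq0.
  by move=> c x y; rewrite !(dotOmegaC _ v) dotOmega_linear.
by move=> c x y; rewrite !(dotOmegaC _ v) dotOmega_linear.
Qed.

Lemma dstar_dstar n (w : OmegaT R G n) : dstar R G n.+1 (dstar R G n w) = 0.
Proof.
apply: dotOmega_eq0; rewrite -!dstarP dOmega_dOmega dotOmegaC.
by rewrite dotOmega0.
Qed.

(** Both sides satisfy the adjunction for the weighted inner products, which
are rescalings of the canonical ones. *)
Lemma wdstarE (a : nat -> R) n : (forall p, 0 < a p) ->
  wdstar G a n = (weight a n.+1 / weight a n) *: dstar R G n.
Proof.
move=> a_gt0.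
have weight_neq0 m : weight a m != 0 by case: m => [|m] /=; rewrite ?oner_neq0 ?gt_eqF.
have wdotE m (u v : OmegaT R G m) :
  wdotOmega a u v = (weight a m)^-1 * dotOmega u v by [].
have linR m (u : OmegaT R G m) : scalar (wdotOmega a u).
  by move=> c x y; rewrite !wdotE dotOmega_linear mulrDr mulrCA.
have linL m (u : OmegaT R G m) : scalar ((wdotOmega a (n := m))^~ u).
  by move=> c x y; rewrite !wdotE !(dotOmegaC _ u) dotOmega_linear mulrDr mulrCA.
have aniso m (u : OmegaT R G m) : wdotOmega a u u = 0 -> u = 0.
  move=> /eqP; rewrite wdotE mulf_eq0 invr_eq0 (negPf (weight_neq0 m)).
  by move=> /eqP/dotOmega_eq0.
apply/lfunP => w; apply: dotOmegaI => u; rewrite scale_lfunE.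
have := @adjointP R _ _ _ _ (dOmega R G n) (linR _) (linL _) (linR _) (linL _)
  (@aniso _) u w.
rewrite -/(wdstar G a n) !wdotE dstarP => E.
have /= := dotOmega_linear u (weight a n.+1 / weight a n) (dstar R G n w) 0.
rewrite dotOmega0 !addr0 => ->.
by rewrite -mulrA E mulVKf//; apply: (weight_neq0 n.+1).
Qed.

Lemma opKE p u : opK R G p u = dOmega R G p.+1 (dstar R G p.+1 u).
Proof. exact: comp_lfunE. Qed.

Lemma opLE p u : opL R G p u = dstar R G p (dOmega R G p u).
Proof. exact: comp_lfunE. Qed.

Lemma opK_opL p : (opK R G p \o opL R G p = 0)%VF.
Proof.
by apply/lfunP => u; rewrite zero_lfunE comp_lfunE opKE opLE dstar_dstar linear0.
Qed.

Lemma opL_opK p : (opL R G p \o opK R G p = 0)%VF.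
Proof.
by apply/lfunP => u; rewrite zero_lfunE comp_lfunE opLE opKE dOmega_dOmega linear0.
Qed.

Lemma hodgeE (a : nat -> R) p : (forall p, 0 < a p) ->
  hodge G a p =
    (a p.+1 / a p) *: opK R G p + (a p / weight a p) *: opL R G p.
Proof.
by move=> a_gt0; rewrite /hodge !wdstarE// -comp_lfunZr -comp_lfunZl.
Qed.

End Adjoints.

Theorem corollary5p2 (R : realType) (G : digraph) (a : nat -> R)
    (a_gt0 : forall p : nat, 0 < a p) (p : nat) :
  spec_pos (hodge G a p) =
    mset_scale (a p.+1 / a p) (spec_pos (opK R G p)) `+`
    mset_scale (a p / weight a p) (spec_pos (opL R G p))
  /\
  spec_pos (hodge G a p) =
    mset_scale (a p / weight a p) (spec_pos (opL R G p)) `+`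
    mset_scale (a p.+1 / a p) (spec_pos (opL R G p.+1)).
Proof.
have weight_gt0 : 0 < weight a p by case: p => [|p] /=; rewrite ?ltr01.
have cK0 : a p.+1 / a p != 0 by rewrite gt_eqF// divr_gt0.
have cL0 : a p / weight a p != 0 by rewrite gt_eqF// divr_gt0.
have first_half : spec_pos (hodge G a p) =
    mset_scale (a p.+1 / a p) (spec_pos (opK R G p)) `+`
    mset_scale (a p / weight a p) (spec_pos (opL R G p)).
  rewrite hodgeE// spec_posD ?spec_posZ//.
    by rewrite -comp_lfunZl -comp_lfunZr opK_opL !scaler0.
  by rewrite -comp_lfunZl -comp_lfunZr opL_opK !scaler0.
split; first exact: first_half.
rewrite first_half [LHS]msetDC; congr (_ `+` mset_scale _ _).
exact: spec_pos_compC.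
Qed.
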